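(* Let $R$ be a principal ideal domain and let $A\in \mathrm{M}_n(R)$ with $n\geq 3$. Assume that for any proper ideal $\mathfrak{m}$ of $R$, the image of $A$ in $\mathrm{M}_n(R/\mathfrak{m})$ is not a scalar matrix. Then, for any $\gamma_1,\dots,\gamma_n\in R$ such that $\gamma_1+\dots+\gamma_n=\mathrm{Tr}(A)$, $A$ is $R$-similar to a matrix with diagonal $(\gamma_1,\dots,\gamma_n)$.
   Context: $\mathrm{M}_n(R)$ denotes the ring of $n\times n$ matrices over $R$. For a commutative ring $R$, two matrices $A,B\in \mathrm{M}_n(R)$ are called $R$-similar if there exists $g\in \mathrm{GL}_n(R)$ such that $gAg^{-1}=B$. A matrix is scalar if it equals $\lambda I_n$ for some $\lambda$ in the ring. A proper ideal is any ideal different from the whole ring (the zero ideal is allowed). *)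

(* Defs.v *)
From mathcomp Require Import all_boot all_algebra.

Set Implicit Arguments.
Unset Strict Implicit.
Unset Printing Implicit Defensive.

Import GRing.Theory.
Local Open Scope ring_scope.

(* Ideals are boolean predicates, as in ring_quotient; classically these are
   all the ideals.  The structure [idealr R] of ring_quotient consists of the
   proper ideals (zero ideal included), whereas [is_ideal] also allows the
   whole ring. *)
Definition is_ideal (R : comNzRingType) (I : {pred R}) : Prop :=
  0 \in I /\ forall a, {in I &, forall u v, a * u + v \in I}.

Definition principal (R : comNzRingType) (I : {pred R}) : Prop :=
  exists d : R, forall x : R, x \in I <-> exists r : R, x = r * d.

Definition is_PID (R : idomainType) : Prop :=
  forall I : {pred R}, is_ideal I -> principal I.

Definition mx_similar (R : comUnitRingType) (n : nat) (A B : 'M[R]_n) : Prop :=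
  exists2 g : 'M[R]_n, g \in unitmx & g *m A *m invmx g = B.

Definition reduce_mx (R : comNzRingType) (m : idealr R) (n : nat)
    (A : 'M[R]_n) : 'M[{ideal_quot m}]_n :=
  map_mx \pi_{ideal_quot m}%qT A.

(* Main.v *)
Require Import Defs.
From HB Require Import structures.
From mathcomp Require Import all_boot all_algebra.
From mathcomp Require Import boolp ring.

Set Implicit Arguments.
Unset Strict Implicit.
Unset Printing Implicit Defensive.

Import GRing.Theory.
Local Open Scope ring_scope.

(* For a row u and a column v with u v = 0, the value u A v is a multiple of an
   off-diagonal entry of some conjugate of A.  As R is Noetherian, some nonzero
   entry b arising in this way is minimal for divisibility.  If a prime p
   divided b, comparing the values on neighbouring pairs (u, v) would show, for
   n >= 3, that A is scalar modulo p; hence b is a unit.  A matrix with an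
   off-diagonal unit can be sheared so that its first diagonal entry is
   prescribed and the complementary block again has an off-diagonal unit. *)

(** * Divisibility in a commutative ring *)

Section Divisibility.

Variable R : comUnitRingType.
Implicit Types a b c d x y : R.

Definition divides d x : Prop := exists r, x = r * d.

Lemma divides_refl d : divides d d.
Proof. by exists 1; rewrite mul1r. Qed.

Lemma divides0 d : divides d 0.
Proof. by exists 0; rewrite mul0r. Qed.

Lemma divides_mull d c x : divides d x -> divides d (c * x).
Proof. by case=> r ->; exists (c * r); rewrite mulrA. Qed.

Lemma dividesD d x y : divides d x -> divides d y -> divides d (x + y).
Proof. by move=> [r ->] [s ->]; exists (r + s); rewrite mulrDl. Qed.

Lemma dividesB d x y : divides d x -> divides d y -> divides d (x - y).
Proof. by move=> [r ->] [s ->]; exists (r - s); rewrite mulrBl. Qed.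

Lemma divides_trans b a c : divides a b -> divides b c -> divides a c.
Proof. by move=> dab [r ->]; apply: divides_mull. Qed.

Lemma divides_unit d x : divides d x -> x \is a GRing.unit -> d \is a GRing.unit.
Proof. by case=> r ->; rewrite unitrM => /andP[]. Qed.

End Divisibility.

(** * Reduction modulo the proper ideal of multiples of a nonunit *)

Definition multiples (R : comUnitRingType) (d : R) : {pred R} :=
  fun x => `[< divides d x >].

Lemma multiples_idealr_closed (R : comUnitRingType) (d : R) :
  d \isn't a GRing.unit -> idealr_closed (multiples d).
Proof.
move=> d_nonunit; split; first exact/asboolP/divides0.
  by apply: contra d_nonunit => /asboolP/divides_unit; apply; apply: unitr1.
move=> a u v /asboolP du /asboolP dv.
by apply/asboolP; apply: dividesD => //; apply: divides_mull.
Qed.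

(** Bridge between entrywise divisibility and the quotient rings of the theorem. The case [d = 0] is
    allowed and gives the zero ideal. *)
Lemma reduce_mx_scalar (R : comUnitRingType) (d : R) n (A : 'M[R]_n) a :
    d \isn't a GRing.unit ->
    (forall i j, divides d (A i j - (a%:M : 'M_n) i j)) ->
  exists m : idealr R, is_scalar_mx (reduce_mx m A).
Proof.
move=> /multiples_idealr_closed Id dA.
pose F := isIdealr.Build R (multiples d) Id.
pose S : idealr R := HB.pack (multiples d) F.
exists S; apply/is_scalar_mxP; exists (\pi_{ideal_quot S}%qT a).
apply/matrixP => i j; rewrite !mxE.
have -> : (\pi_{ideal_quot S}%qT a : {ideal_quot S}) *+ (i == j)
        = \pi_{ideal_quot S}%qT ((a%:M : 'M_n) i j).
  rewrite mxE; case: eqP => _; rewrite ?mulr1n // !mulr0n.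
  exact/esym/(rmorph0 (\pi_{ideal_quot S}%qT)).
by apply/eqP; rewrite -Quotient.idealrBE; apply/asboolP/dA.
Qed.

(** * Bezout relations, minimal elements and primes in a PID *)

Section PrincipalIdealDomain.

Variables (R : idomainType) (R_PID : is_PID R).
Implicit Types a b c d x y : R.

Lemma PID_generator (I : R -> Prop) :
    I 0 -> (forall a x y, I x -> I y -> I (a * x + y)) ->
  exists2 d, I d & forall x, I x -> divides d x.
Proof.
move=> I0 ID.
have [|d dI] := R_PID (I := fun x => `[< I x >]).
  by split=> [|a x y /asboolP Ix /asboolP Iy]; apply/asboolP => //; apply: ID.
have Id : I d by apply/asboolP/dI; apply: divides_refl.
by exists d => // x Ix; apply/dI/asboolP.
Qed.

Lemma PID_bezout a b :
  exists2 d, divides d a /\ divides d b & exists r s, d = r * a + s * b.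
Proof.
have [|c x y [r [s ->]] [r' [s' ->]]|d [r [s Ed]] dI] :=
    @PID_generator (fun x => exists r s, x = r * a + s * b).
- by exists 0, 0; rewrite !mul0r addr0.
- by exists (c * r + r'), (c * s + s'); ring.
exists d; last by exists r, s.
split; apply: dI; first by exists 1, 0; rewrite mul1r mul0r addr0.
by exists 0, 1; rewrite mul1r mul0r add0r.
Qed.

(* Otherwise the principal ideals of some sequence strictly increase, whereas a
   generator of their union already lies in one of them. *)
Lemma PID_minimal (P : R -> Prop) :
  (exists b, P b) -> exists2 b, P b & forall c, P c -> divides c b -> divides b c.
Proof.
move=> [b0 Pb0]; apply: contrapT => noMin.
have next (b : {b | P b}) :
    {c : {c | P c} | divides (sval c) (sval b) /\ ~ divides (sval b) (sval c)}.
  apply: cid; apply: contrapT => H; apply: noMin; exists (sval b) => [|c Pc cb].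
    exact: svalP.
  by apply: contrapT => nbc; apply: H; exists (exist _ c Pc).
pose f n := iter n (fun s => sval (next s)) (exist _ b0 Pb0).
have fS n : divides (sval (f n.+1)) (sval (f n)) /\
            ~ divides (sval (f n)) (sval (f n.+1)) by apply: svalP (next (f n)).
have fle m n : (m <= n)%N -> divides (sval (f n)) (sval (f m)).
  elim: n => [|n IH]; first by rewrite leqn0 => /eqP->; apply: divides_refl.
  rewrite leq_eqVlt => /predU1P[->|/IH]; first exact: divides_refl.
  by apply: divides_trans; case: (fS n).
have [|a x y [m mx] [n ny]|d [n nd] dI] :=
    @PID_generator (fun x => exists n, divides (sval (f n)) x).
- by exists 0; apply: divides0.
- exists (maxn m n); apply: dividesD; first apply: divides_mull.
    exact: divides_trans (fle _ _ (leq_maxl m n)) mx.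
  exact: divides_trans (fle _ _ (leq_maxr m n)) ny.
case: (fS n) => _; apply; apply: divides_trans nd _.
by apply: dI; exists n.+1; apply: divides_refl.
Qed.

(** Take [p] minimal among the nonunit divisors of [b]. The gcd of [p] and [x] is either a unit, and
    Bezout then gives primality, or a nonunit, hence by minimality a multiple of [p], so that [p]
    divides [x]. *)
Lemma PID_prime_divisor b : b != 0 -> b \isn't a GRing.unit ->
  exists p, [/\ divides p b, p \isn't a GRing.unit &
    forall x y, divides p (x * y) -> ~ divides p x -> divides p y].
Proof.
move=> b0 b_nonunit.
have [|p [pb p_nonunit] p_min] :=
    @PID_minimal (fun p => divides p b /\ p \isn't a GRing.unit).
  by exists b; split=> //; apply: divides_refl.
exists p; split=> // x y pxy npx.
have [d [dp dx] [r [s Ed]]] := PID_bezout p x.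
have [d_unit|d_nonunit] := boolP (d \is a GRing.unit); last first.
  case: npx; apply: divides_trans dx; apply: p_min => //.
  by split=> //; apply: divides_trans pb.
rewrite -[y](mulKr d_unit); apply: divides_mull; rewrite Ed mulrDl -!mulrA.
by apply: dividesD; apply: divides_mull => //; exists y; rewrite mulrC.
Qed.

End PrincipalIdealDomain.

(** * Similarity, shears and prescribed diagonals *)

Section Similarity.

Variable R : comUnitRingType.

Lemma mx_similar_conj n (g h A : 'M[R]_n) :
  g *m h = 1%:M -> mx_similar A (g *m A *m h).
Proof.
move=> gh1; have [Ug _] := mulmx1_unit gh1; exists g => //.
by rewrite -[h](mulKmx Ug) gh1 mulmx1.
Qed.

Lemma mx_similar_refl n (A : 'M[R]_n) : mx_similar A A.
Proof. by exists 1%:M; rewrite ?unitmx1 // invmx1 mulmx1 mul1mx. Qed.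

Lemma mx_similar_trans n (B A C : 'M[R]_n) :
  mx_similar A B -> mx_similar B C -> mx_similar A C.
Proof.
move=> [g Ug <-] [h Uh <-].
rewrite [X in mx_similar _ X](_ : _ = (h *m g) *m A *m (invmx g *m invmx h)).
  by apply: mx_similar_conj; rewrite mulmxA mulmxK // mulmxV.
by rewrite !mulmxA.
Qed.

Lemma mx_similar_tr n (A B : 'M[R]_n) : mx_similar A B -> mx_similar A^T B^T.
Proof.
move=> [g Ug <-]; rewrite !trmx_mul mulmxA; apply: mx_similar_conj.
by rewrite -trmx_mul mulmxV // trmx1.
Qed.

Lemma mx_similar_trace n (A B : 'M[R]_n) : mx_similar A B -> \tr A = \tr B.
Proof. by move=> [g Ug <-]; rewrite mxtrace_mulC mulKmx. Qed.

(** Conjugate by the unipotent matrix with lower left block [x], then by the block diagonal matrix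
    of 1 and [g]; the latter leaves the corner unchanged. *)
Lemma mx_similar_block_shear n (M : 'M[R]_(1 + n)) (x : 'cV[R]_n) (D : 'M[R]_n) :
    mx_similar (drsubmx M + x *m ursubmx M) D ->
  exists r c, mx_similar M (block_mx (ulsubmx M - ursubmx M *m x) r c D).
Proof.
move=> [g Ug <-].
have sh : block_mx 1%:M 0 x 1%:M *m block_mx 1%:M 0 (- x) 1%:M
        = 1%:M :> 'M[R]_(1 + n).
  rewrite mulmx_block !(mul0mx, mulmx0, mul1mx, mulmx1, addr0, add0r) subrr.
  by rewrite -scalar_mx_block.
have gV : block_mx 1%:M 0 0 g *m block_mx 1%:M 0 0 (invmx g)
        = 1%:M :> 'M[R]_(1 + n).
  rewrite mulmx_block !(mul0mx, mulmx0, mul1mx, mulmx1, addr0, add0r).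
  by rewrite mulmxV // -scalar_mx_block.
have [r [c E]] : exists r c,
    block_mx 1%:M 0 0 g
      *m (block_mx 1%:M 0 x 1%:M *m M *m block_mx 1%:M 0 (- x) 1%:M)
      *m block_mx 1%:M 0 0 (invmx g)
   = block_mx (ulsubmx M - ursubmx M *m x) r c
       (g *m (drsubmx M + x *m ursubmx M) *m invmx g).
  rewrite -[M in X in exists r c, X = _]submxK !mulmx_block.
  rewrite !(mul0mx, mulmx0, mul1mx, mulmx1, addr0, add0r) mulmxN.
  by do 2!eexists; rewrite [x *m _ + drsubmx M]addrC.
exists r, c; rewrite -E.
exact: mx_similar_trans (mx_similar_conj M sh) (mx_similar_conj _ gV).
Qed.

(* In block form M = [[a, r], [c, D]], a shear by x turns a into a - r x and D
   into D + x r; the first coordinate of x adjusts the corner, the second one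
   creates a unit entry in the lower block, on which the induction proceeds. *)
Lemma unit_entry_similar_diag n (M : 'M[R]_n.+2) (gamma : 'I_n.+2 -> R) :
    M 0 1 \is a GRing.unit -> \sum_i gamma i = \tr M ->
  exists2 B : 'M[R]_n.+2, mx_similar M B & forall i, B i i = gamma i.
Proof.
elim: n => [|n IH] in M gamma * => UM tr_gamma.
  pose M' : 'M[R]_(1 + 1) := M.
  pose x : 'cV[R]_1 := const_mx ((M 0 0 - gamma 0) / M 0 1).
  have [r [c MB]] := mx_similar_block_shear
    (mx_similar_refl (drsubmx M' + x *m ursubmx M')).
  have B00 : (ulsubmx M' - ursubmx M' *m x) 0 0 = gamma 0.
    have r0 : ursubmx M' 0 0 = M 0 1 by rewrite !mxE;
      congr (M _ _); apply: val_inj.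
    have a0 : ulsubmx M' 0 0 = M 0 0 by rewrite !mxE; congr (M _ _); apply: val_inj.
    rewrite mxE a0 [X in _ + X]mxE [X in - X]mxE big_ord1 r0 [x _ _]mxE.
    by rewrite mulrC divrK // subKr.
  eexists; first exact: MB.
  (* The corner is already right, so the trace forces the other diagonal entry. *)
  move=> i; have tr_eq := mx_similar_trace MB.
  rewrite -tr_gamma mxtrace_block /mxtrace !big_ord_recl !big_ord0 !addr0 B00 in tr_eq.
  have := tr_eq => /addrI tr_eq1.
  case: (@split_ordP 1 1 i) => j ->; rewrite ord1.
    by rewrite [LHS]block_mxEul B00; congr gamma; apply: val_inj.
  rewrite [LHS]block_mxEdr -tr_eq1; congr gamma; exact: val_inj.
pose M' : 'M[R]_(1 + n.+2) := M.
(* [x1] solves [D 1 0 = 1]; given [x1], [x0] brings the corner to [gamma 0]. *)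
pose x1 := (1 - drsubmx M' 1 0) / M 0 1.
pose x0 := (M 0 0 - gamma 0 - ursubmx M' 0 1 * x1) / M 0 1.
pose x : 'cV[R]_n.+2 := \col_i if i == 0 then x0 else if i == 1 then x1 else 0.
have r0 : ursubmx M' 0 0 = M 0 1 by rewrite !mxE; congr (M _ _); apply: val_inj.
have a0 : ulsubmx M' 0 0 = M 0 0 by rewrite !mxE; congr (M _ _); apply: val_inj.
have B00 : (ulsubmx M' - ursubmx M' *m x) 0 0 = gamma 0.
  rewrite mxE a0 [X in _ + X]mxE [X in - X]mxE !big_ord_recl big1 => [|i _].
    2: by rewrite [x _ _]mxE mulr0.
  have -> : lift ord0 ord0 = 1 :> 'I_n.+2 by apply: val_inj.
  rewrite r0 [x 0 0]mxE [x 1 0]mxE /= addr0.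
  by rewrite /x0 mulrC divrK // subrK subKr.
pose D := drsubmx M' + x *m ursubmx M'.
have D10 : D 1 0 = 1.
  by rewrite mxE [X in _ + X]mxE big_ord1 r0 [x _ _]mxE /x1 /= divrK // addrC subrK.
have trD : \tr D = \sum_i gamma (lift 0 i).
  have [r [c MB]] := mx_similar_block_shear (mx_similar_refl D).
  have := mx_similar_trace MB; rewrite -tr_gamma mxtrace_block [X in X + _]/mxtrace.
  by rewrite big_ord1 B00 big_ord_recl => /addrI.
(* The unit of [D] sits at (1, 0), not (0, 1); transposing moves it and keeps the diagonal. *)
have [||B DB Bgamma] := IH D^T (fun i => gamma (lift 0 i)).
- by rewrite mxE D10 unitr1.
- by rewrite mxtrace_tr trD.
have := mx_similar_tr DB; rewrite trmxK => /mx_similar_block_shear[r [c MB]].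
eexists; first exact: MB.
move=> i; case: (@split_ordP 1 n.+2 i) => j ->.
  by rewrite ord1 [LHS]block_mxEul B00; congr gamma; apply: val_inj.
by rewrite [LHS]block_mxEdr mxE Bgamma; congr gamma; apply: val_inj.
Qed.

End Similarity.

(** * Reduction of rows and orthogonal pairs over a PID *)

Section RowReduction.

Variables (R : idomainType) (R_PID : is_PID R).

(** This is [[r, -b], [s, a]], of determinant 1, acting on the first two coordinates; [h] extends
    its inverse [[a, b], [-s, r]] in the same way. *)
Lemma bezout_block_unitmx n (r s a b : R) : r * a + s * b = 1 ->
  (block_mx r%:M (- b *: delta_mx 0 0) (s *: delta_mx 0 0)
     (1%:M + (a - 1) *: delta_mx 0 0) : 'M[R]_(1 + n.+1)) \in unitmx.
Proof.
move=> rasb.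
pose h : 'M[R]_(1 + n.+1) := block_mx a%:M (b *: delta_mx 0 0)
  (- s *: delta_mx 0 0) (1%:M + (r - 1) *: delta_mx 0 0).
have {}rasb : s * b = 1 - r * a by
  apply: (addrI (r * a)); rewrite rasb addrC subrK.
suff /mulmx1_unit[] : block_mx r%:M (- b *: delta_mx 0 0) (s *: delta_mx 0 0)
     (1%:M + (a - 1) *: delta_mx 0 0) *m h = 1%:M by [].
rewrite mulmx_block scalar_mx_block.
congr block_mx; apply/matrixP => i j; rewrite !(mulmxDl, mulmxDr, mul_scalar_mx,
  mul_mx_scalar, mul1mx, mulmx1, =^~ scalemxAl, =^~ scalemxAr, mul_delta_mx, scalerA) !mxE.
- rewrite !ord1 !eqxx /= !mulr1n; ring: rasb.
- by case: eqP => _; case: eqP => _ /=; ring: rasb.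
- by case: eqP => _; case: eqP => _ /=; ring: rasb.
- by case: eqP => _; case: eqP => _; case: eqP => _ /=; ring: rasb.
Qed.

(** Once the tail is reduced to a single entry [e], a Bezout matrix turns the leading pair ([a],
    [e]) into ([d], 0) with [d] their gcd. *)
Lemma row_reduction n (u : 'rV[R]_n.+1) :
  exists2 g : 'M[R]_n.+1, g \in unitmx & exists d, u *m g = d *: delta_mx 0 0.
Proof.
elim: n u => [|n IH] u.
  exists 1%:M; first exact: unitmx1.
  by exists (u 0 0); apply/rowP => i; rewrite mulmx1 !mxE !ord1 eqxx mulr1.
pose u' : 'rV[R]_(1 + n.+1) := u.
have [g Ug [e ug]] := IH (rsubmx u').
pose g1 : 'M[R]_(1 + n.+1) := block_mx 1%:M 0 0 g.
have Ug1 : g1 \in unitmx by rewrite unitmxE det_ublock det1 mul1r.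
have ug1 : u' *m g1 = row_mx (lsubmx u') (e *: delta_mx 0 0).
  by rewrite -[u' in LHS]hsubmxK mul_row_block mulmx1 !mulmx0 addr0 add0r ug.
pose a := lsubmx u' 0 0.
have lu : lsubmx u' = a%:M by apply/rowP => i; rewrite !ord1 [RHS]mxE eqxx.
have [d [[a' Ea] [e' Ee]] [r [s Ed]]] := PID_bezout R_PID a e.
(* The cofactors satisfy a Bezout relation only after cancelling [d]; if [d] is 0, the row is
   already zero after [g1]. *)
have [d0|d0] := eqVneq d 0.
  exists g1 => //; exists 0; rewrite scale0r [LHS]ug1 lu Ea Ee d0 !mulr0.
  by rewrite scale0r (raddf0 (@scalar_mx R 1)) row_mx0.
have rs1 : r * a' + s * e' = 1.
  by apply: (mulIf d0); rewrite mul1r mulrDl -!mulrA -Ea -Ee -Ed.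
pose k : 'M[R]_(1 + n.+1) := block_mx r%:M (- e' *: delta_mx 0 0)
  (s *: delta_mx 0 0) (1%:M + (a' - 1) *: delta_mx 0 0).
exists (g1 *m k); first by rewrite unitmx_mul Ug1; apply: bezout_block_unitmx.
exists d; have -> : u *m (g1 *m k) = row_mx d%:M 0.
  rewrite mulmxA [u *m g1]ug1 lu [LHS]mul_row_block.
  congr row_mx; apply/rowP => i; rewrite !(mulmxDl, mulmxDr, mul_scalar_mx,
    mul_mx_scalar, mul1mx, mulmx1, =^~ scalemxAl, =^~ scalemxAr, mul_delta_mx,
    scalerA) !mxE.
    rewrite !ord1 !eqxx /= Ed; ring.
  by case: eqP => _; rewrite Ea Ee /=; ring.
apply/rowP => j; case: (@split_ordP 1 n.+1 j) => i ->.
  by rewrite [LHS]row_mxEl !ord1 !mxE mulr1.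
by rewrite [LHS]row_mxEr !mxE mulr0.
Qed.

(** In a basis where [u] is [d] times the first unit row, orthogonality kills the first coordinate
    of [v]. Reducing the remaining ones to [e] times a unit column keeps [u], so the value is
    [d * e] times the entry at (0, 1). *)
Lemma orthogonal_pair_entry n (A : 'M[R]_n.+2) (u : 'rV_n.+2) (v : 'cV_n.+2) :
    u *m v = 0 -> (u *m A *m v) 0 0 != 0 ->
  exists2 B, mx_similar A B & divides (B 0 1) ((u *m A *m v) 0 0).
Proof.
move=> uv0 uAv.
have [g Ug [d ug]] := row_reduction u.
have Eu : u = d *: delta_mx 0 0 *m invmx g by rewrite -ug mulmxK.
have d0 : d != 0 by apply: contra_neq uAv => d0; rewrite Eu d0 scale0r !mul0mx mxE.
pose w : 'cV[R]_(1 + n.+1) := invmx g *m v.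
have wu : usubmx w = 0.
  have := congr1 (fun X : 'M_1 => X 0 0) uv0.
  rewrite /= Eu -mulmxA -scalemxAl -rowE -/w [LHS]mxE [X in _ * X]mxE [RHS]mxE.
  move/eqP; rewrite mulf_eq0 (negPf d0) /= => /eqP w0.
  apply/colP => i; rewrite ord1 [RHS]mxE -w0 mxE.
  by congr (w _ _); apply: val_inj.
have [h Uh [e wh]] := row_reduction (dsubmx w)^T.
pose k : 'M[R]_(1 + n.+1) := block_mx 1%:M 0 0 h^T.
have Uk : k \in unitmx by rewrite unitmxE det_ublock det1 mul1r -unitmxE unitmx_tr.
pose q := invmx k.
have kw : k *m w = e *: delta_mx 1 0.
  rewrite -[w]vsubmxK wu mul_block_col !(mulmx0, mul0mx) addr0 add0r.
  rewrite -[dsubmx w]trmxK -trmx_mul wh.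
  apply/colP => i; case: (@split_ordP 1 n.+1 i) => j ->.
    by rewrite col_mxEu !mxE !ord1 mulr0.
  by rewrite col_mxEd !mxE andbT.
have dk : delta_mx 0 0 *m k = delta_mx 0 0 :> 'rV_(1 + n.+1).
  have k0 i : k 0 i = k (lshift n.+1 0) i by congr (k _ _); apply: val_inj.
  rewrite -rowE; apply/rowP => i; rewrite mxE k0; case: (@split_ordP 1 n.+1 i) => j ->.
    by rewrite block_mxEul !mxE !ord1.
  by rewrite block_mxEur !mxE.
exists (k *m invmx g *m A *m (g *m invmx k)).
  by apply: mx_similar_conj; rewrite mulmxA mulmxKV // mulmxV.
exists (d * e).
have -> : v = g *m (invmx k *m (e *: delta_mx 1 0)) by rewrite -kw mulKmx // mulKVmx.
have -> : u = d *: (delta_mx 0 0 *m k *m invmx g) by rewrite dk scalemxAl.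
rewrite -!(scalemxAl, scalemxAr) !mulmxA -colE 3!mxE mulrA; congr (_ * _).
by rewrite -!mulmxA -rowE mxE.
Qed.

End RowReduction.

Local Notation form A u v := ((u *m A *m v) 0 0).

(** * Values on orthogonal pairs that are minimal for divisibility *)

Section MinimalValue.

Variables (R : idomainType) (R_PID : is_PID R).

Definition minimal_value n (A : 'M[R]_n) b : Prop :=
  b != 0 /\ forall (u : 'rV_n) (v : 'cV_n), u *m v = 0 -> form A u v != 0 ->
    divides (form A u v) b -> divides b (form A u v).

Lemma form_tr n (A : 'M[R]_n) (u : 'rV_n) (v : 'cV_n) :
  form A^T v^T u^T = form A u v.
Proof. by rewrite -!trmx_mul mxE mulmxA. Qed.

Lemma minimal_value_tr n (A : 'M[R]_n) b :
  minimal_value A b -> minimal_value A^T b.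
Proof.
move=> [b0 bmin]; split=> // u v uv0.
rewrite -[u]trmxK -[v]trmxK form_tr.
by apply: bmin; rewrite -trmx_mul uv0 trmx0.
Qed.

(** For fixed [u] the values form an ideal, and its generator is again a value. *)
Lemma row_values_generator n (A : 'M[R]_n) (u : 'rV_n) :
  exists2 v : 'cV_n, u *m v = 0 &
    forall w : 'cV_n, u *m w = 0 -> divides (form A u v) (form A u w).
Proof.
have [|a x y [v uv0 <-] [w uw0 <-]|d [v uv0 <-] dI] := PID_generator R_PID
    (I := fun x => exists2 v : 'cV_n, u *m v = 0 & form A u v = x).
- by exists 0; rewrite mulmx0 // mxE.
- exists (a *: v + w); first by rewrite mulmxDr -scalemxAr uv0 uw0 scaler0 addr0.
  by rewrite mulmxDr -scalemxAr !mxE.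
by exists v => // w uw0; apply: dI; exists w.
Qed.

(** The generator of the values on [u] is a value dividing [b], so [b] divides it by minimality. *)
Lemma minimal_value_row n (A : 'M[R]_n) b (u : 'rV_n) (v w : 'cV_n) :
    minimal_value A b -> u *m v = 0 -> form A u v = b -> u *m w = 0 ->
  divides b (form A u w).
Proof.
move=> [b0 bmin] uv0 uAv uw0.
have [v0 uv00 gen] := row_values_generator A u.
apply: divides_trans (gen _ uw0).
have := gen _ uv0; rewrite uAv => db; apply: bmin => //.
by apply: contra_neq b0 => E; case: db => r; rewrite E mulr0.
Qed.

Lemma minimal_value_col n (A : 'M[R]_n) b (u w : 'rV_n) (v : 'cV_n) :
    minimal_value A b -> u *m v = 0 -> form A u v = b -> w *m v = 0 ->
  divides b (form A w v).
Proof.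
move=> /minimal_value_tr bmin uv0 uAv wv0.
rewrite -form_tr; apply: (minimal_value_row (v := u^T)) => //.
- by rewrite -trmx_mul uv0 trmx0.
- by rewrite form_tr.
- by rewrite -trmx_mul wv0 trmx0.
Qed.

(** Every 2 by 2 minor of the rows [u] and [u *m A] is a value on [u]. *)
Lemma minor_value n (A : 'M[R]_n) (u : 'rV_n) i j :
  exists2 v : 'cV_n, u *m v = 0 &
    form A u v = u 0 i * (u *m A) 0 j - u 0 j * (u *m A) 0 i.
Proof.
exists (u 0 i *: delta_mx j 0 - u 0 j *: delta_mx i 0).
  rewrite mulmxBr -!scalemxAr -!colE; apply/matrixP => k l.
  by rewrite !mxE !ord1 mulrC subrr.
by rewrite mulmxBr -!scalemxAr -!colE !mxE.
Qed.

(** * Congruences modulo a prime divisor of a minimal value *)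

Section ModuloPrime.

Variables (n : nat) (A : 'M[R]_n.+1) (b p : R).
Hypotheses (b_min : minimal_value A b) (pb : divides p b).
Hypothesis p_prime : forall x y, divides p (x * y) -> ~ divides p x -> divides p y.

Local Notation u := (delta_mx 0 0 : 'rV[R]_n.+1).

Lemma divides_first_row (v : 'cV_n.+1) k : u *m v = 0 -> form A u v = b -> k != 0 ->
  divides p (A 0 k).
Proof.
move=> uv0 uAv k0; have [w uw0 Ew] := minor_value A u 0 k.
have := minimal_value_row b_min uv0 uAv uw0.
rewrite Ew -rowE !mxE (negPf k0) mul1r mul0r subr0.
exact: divides_trans.
Qed.

(* The value b is attained on the row u + z, so by minimality b divides its
   minors.  On p u + z the value p b is attained; a value c there with p not
   dividing c would divide b, contradicting minimality, so p divides the minors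
   of p u + z.  Comparing the two, z is an eigenvector modulo p. *)
Lemma divides_eigenrow (v : 'cV_n.+1) (z : 'rV_n.+1) j k :
    u *m v = 0 -> form A u v = b -> z *m v = 0 -> z 0 j = 1 -> j != 0 ->
  divides p ((z *m A) 0 k - A 0 0 * z 0 k).
Proof.
move=> uv0 uAv.
(* As [b] divides the value of [z] at [v], subtracting a multiple of [u] from [z] makes it vanish.
   This keeps [z 0 j] and changes the claim by a multiple of [p]. *)
wlog zAv : z / form A z v = 0 => [IH zv0 zj j0|zv0 zj j0].
  have [l El] := minimal_value_col b_min uv0 uAv zv0.
  have := IH (z - l *: u) _ _ _ j0.
  rewrite !mulmxBl -!scalemxAl uv0 zv0 scaler0 subr0 => /(_ _ erefl) H.
  have {}H : divides p ((z *m A - l *: (u *m A)) 0 k - A 0 0 * (z - l *: u) 0 k).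
    apply: H; first by rewrite mxE [X in _ + X]mxE [X in - X]mxE El uAv subrr.
    by rewrite !mxE (negPf j0) mulr0 subr0.
  rewrite -rowE !mxE in H *.
  have [k0|k0] := eqVneq k 0.
    move: H; rewrite k0 eqxx /=; congr divides; ring.
  have := dividesD H (divides_mull l (divides_first_row uv0 uAv k0)).
  rewrite (negPf k0) /=; congr divides; ring.
have minors_sum i k' : divides p ((u + z) 0 i * ((u + z) *m A) 0 k' -
    (u + z) 0 k' * ((u + z) *m A) 0 i).
  have [w w0 <-] := minor_value A (u + z) i k'; apply: divides_trans pb _.
  apply: (@minimal_value_row _ _ _ _ v) => //.
    by rewrite mulmxDl uv0 zv0 addr0.
  by rewrite !mulmxDl mxE uAv zAv addr0.
have minors_z i k' : divides p (z 0 i * (z *m A) 0 k' - z 0 k' * (z *m A) 0 i).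
  pose y := p *: u + z.
  suff dy (w : 'cV_n.+1) : y *m w = 0 -> divides p (form A y w).
    have [w /dy + E] := minor_value A y i k'; rewrite E /y => H.
    rewrite !mulmxDl -!scalemxAl -rowE !mxE in H.
    have := dividesB H (divides_mull ((i == 0)%:R * (p * A 0 k' + (z *m A) 0 k')
       + z 0 i * A 0 k' - (k' == 0)%:R * (p * A 0 i + (z *m A) 0 i) - z 0 k' * A 0 i)
       (divides_refl p)).
    rewrite !mxE; congr divides; rewrite /=. ring.
  move=> yw0; have [v0 yv0 gen] := row_values_generator A y.
  apply: divides_trans (gen _ yw0); set c := form A y v0 in gen *.
  have [e pbE] : divides c (p * b).
    have := gen v; rewrite /y !mulmxDl -!scalemxAl uv0 zv0 scaler0 addr0.
    by rewrite mxE zAv addr0 mxE uAv; apply.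
  apply: contrapT => npc; have [f Ef] : divides p e.
    apply: (p_prime (x := c)) => //; exists b; by rewrite mulrC -pbE mulrC.
  have p0 : p != 0.
    apply: contra_neq (b_min.1) => p0; case: pb => r; by rewrite p0 mulr0.
  have Eb : b = f * c by apply: (mulfI p0); rewrite pbE Ef mulrCA mulrA.
  apply: npc; apply: divides_trans pb _; apply: b_min.2 => //; last by exists f.
  by apply: contra_neq (b_min.1) => c0; rewrite Eb /c c0 mulr0.
have eig i : i != 0 -> divides p ((z *m A) 0 i - A 0 0 * z 0 i).
  move=> i0; have := minors_sum 0 i; rewrite !mulmxDl -rowE !mxE eqxx (negPf i0) => H.
  have := dividesB (dividesB H (minors_z 0 i))
    (divides_mull (1 + z 0 0) (divides_first_row uv0 uAv i0)).
  rewrite !mxE; congr divides; rewrite /=; ring.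
(* Coordinate 0 follows from coordinate [j] through the minor (0, [j]) of [z], since [z 0 j] is
   1. *)
have [k0|] := eqVneq k 0; last exact: eig.
have := dividesB (divides_mull (z 0 0) (eig j j0)) (minors_z 0 j).
rewrite k0 zj; congr divides; ring.
Qed.

End ModuloPrime.

(** The pair of unit vectors 0 and 1 attains the minimal value. Each unit row other than row 1 kills
    [v], hence is an eigenvector modulo [p]; row 1 requires a third index. *)
Lemma minimal_entry_scalar n (A : 'M[R]_n.+3) p :
    minimal_value A (A 0 1) -> divides p (A 0 1) ->
    (forall x y, divides p (x * y) -> ~ divides p x -> divides p y) ->
  forall i j, divides p (A i j - ((A 0 0)%:M : 'M_n.+3) i j).
Proof.
move=> b_min pb p_prime i j.
pose e2 : 'I_n.+3 := inord 2.
have e20 : (e2 == 0) = false by apply/eqP => /(congr1 val); rewrite /= inordK.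
have e21 : (e2 == 1) = false by apply/eqP => /(congr1 val); rewrite /= inordK.
pose v : 'cV[R]_n.+3 := delta_mx 1 0.
have uv0 : (delta_mx 0 0 : 'rV_n.+3) *m v = 0 by rewrite mul_delta_mx_0.
have uAv : ((delta_mx 0 0 : 'rV_n.+3) *m A *m v) 0 0 = A 0 1.
  by rewrite -rowE -colE !mxE.
have rows k : k != 1 -> divides p (A k j - ((A 0 0)%:M : 'M_n.+3) k j).
  move=> k1; have [->|k0] := eqVneq k 0.
    rewrite mxE; have [<-|j0] := eqVneq 0 j; first by rewrite subrr; apply: divides0.
    rewrite subr0; apply: (divides_first_row b_min pb uv0 uAv).
    by rewrite eq_sym.
  have := @divides_eigenrow _ A _ _ b_min pb p_prime v (delta_mx 0 k) k j uv0 uAv.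
  rewrite mul_delta_mx_0 // -rowE !mxE !eqxx => /(_ erefl erefl k0).
  rewrite [k == j]eq_sym -[A 0 0 *+ _]mulr_natr; congr divides.
have [->|/rows//] := eqVneq i 1.
(* Moving v inside the kernel of the first row brings in the missing row. *)
have [t Et] : divides (A 0 1) (A 0 e2).
  have := minimal_value_row (w := delta_mx e2 0) b_min uv0 uAv.
  rewrite mul_delta_mx_0 1?eq_sym ?e20 // -rowE -colE !mxE; exact.
(* The coefficient [1 - t] keeps the value on the first row equal to [A 0 1]. *)
pose v' : 'cV[R]_n.+3 := (1 - t) *: delta_mx 1 0 + delta_mx e2 0.
have uv'0 : (delta_mx 0 0 : 'rV_n.+3) *m v' = 0.
  by rewrite mulmxDr -scalemxAr !mul_delta_mx_0 ?scaler0 ?addr0 // eq_sym e20.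
have uAv' : ((delta_mx 0 0 : 'rV_n.+3) *m A *m v') 0 0 = A 0 1.
  by rewrite mulmxDr -scalemxAr -rowE -!colE !mxE Et; ring.
pose z : 'rV[R]_n.+3 := delta_mx 0 1 - (1 - t) *: delta_mx 0 e2.
have zv'0 : z *m v' = 0.
  rewrite mulmxDr !mulmxBl -!(scalemxAl, scalemxAr) !mul_delta_mx.
  rewrite [_ *m delta_mx 1 0]mul_delta_mx_0 ?e21 //.
  rewrite [_ *m delta_mx e2 0]mul_delta_mx_0 ?[1 == e2]eq_sym ?e21 //.
  by rewrite !scaler0 subr0 sub0r subrr.
have z1 : z 0 1 = 1 by rewrite !mxE [1 == e2]eq_sym e21 mulr0 subr0.
have := @divides_eigenrow _ A _ _ b_min pb p_prime v' z 1 j uv'0 uAv' zv'0 z1 isT.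
move=> /dividesD/(_ (divides_mull (1 - t) (rows e2 (negbT e21)))).
rewrite mulmxBl -scalemxAl -!rowE !mxE; congr divides.
rewrite ![_ == j]eq_sym -![A 0 0 *+ _]mulr_natr; ring.
Qed.

End MinimalValue.

(** * Scalar matrices, the unit entry and the conclusion *)

Lemma divides_sum (R : comUnitRingType) (I : finType) (d : R) (F : I -> R) :
  (forall i, divides d (F i)) -> divides d (\sum_i F i).
Proof. by move=> dF; elim/big_ind: _ => //; [apply: divides0|apply: dividesD]. Qed.

Lemma divides_similar_scalar (R : comUnitRingType) n (A B : 'M[R]_n) p a :
    mx_similar A B -> (forall i j, divides p (B i j - (a%:M : 'M_n) i j)) ->
  forall i j, divides p (A i j - (a%:M : 'M_n) i j).
Proof.
move=> [g Ug <-] pB i j.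
have -> : A i j - (a%:M : 'M_n) i j
        = (invmx g *m ((g *m A *m invmx g) - a%:M) *m g) i j.
  rewrite mulmxBr mulmxBl !mulmxA mulVmx // mul1mx mulmxKV //.
  by rewrite mul_mx_scalar -scalemxAl mulVmx // scalemx1 !mxE.
rewrite mxE; apply: divides_sum => k; rewrite mulrC mxE.
apply: divides_mull; apply: divides_sum => l; apply: divides_mull.
by rewrite mxE [X in _ + X]mxE; apply: pB.
Qed.

(** Pairs of distinct unit vectors kill the off-diagonal entries; the sum and difference of unit
    vectors [i] and 0 then equate diagonal entries. *)
Lemma orthogonal_values0_scalar (R : comUnitRingType) n (A : 'M[R]_n.+1) :
    (forall (u : 'rV_n.+1) (v : 'cV_n.+1), u *m v = 0 -> form A u v = 0) ->
  A = (A 0 0)%:M.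
Proof.
move=> A0.
have offdiag i j : i != j -> A i j = 0.
  move=> ij; have := A0 (delta_mx 0 i) (delta_mx j 0).
  by rewrite mul_delta_mx_0 // -rowE -colE !mxE; apply.
apply/matrixP => i j; rewrite mxE; case: eqVneq => [<-|/offdiag//].
have [->//|i0] := eqVneq i 0.
pose u : 'rV[R]_n.+1 := delta_mx 0 i + delta_mx 0 0.
pose v : 'cV[R]_n.+1 := delta_mx i 0 - delta_mx 0 0.
have /A0 : u *m v = 0.
  rewrite mulmxBr !mulmxDl !mul_delta_mx !mul_delta_mx_0 // 1?eq_sym //.
  by rewrite addr0 add0r subrr.
rewrite mulmxBr !mulmxDl -!rowE -!colE.
rewrite !mxE (offdiag i 0) // (offdiag 0 i) 1?eq_sym // addr0 add0r.
by move/eqP; rewrite subr_eq0 => /eqP.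
Qed.

Lemma similar_unit_entry (R : idomainType) (R_PID : is_PID R) n (A : 'M[R]_n.+3) :
    (forall m : idealr R, ~ is_scalar_mx (reduce_mx m A)) ->
  exists2 B, mx_similar A B & B 0 1 \is a GRing.unit.
Proof.
move=> A_nonscalar.
pose T c := c != 0 /\ exists2 B, mx_similar A B & B 0 1 = c.
have value_entry B (u : 'rV_n.+3) (v : 'cV_n.+3) : mx_similar A B ->
    u *m v = 0 -> form B u v != 0 -> exists2 c, T c & divides c (form B u v).
  move=> AB uv0 uBv; have [C BC dC] := orthogonal_pair_entry R_PID uv0 uBv.
  exists (C 0 1) => //; split; last by exists C => //; apply: mx_similar_trans BC.
  by apply: contra_neq uBv => C0; case: dC => r ->; rewrite C0 mulr0.
have [|b [b0 [B AB Bb]] b_min] := @PID_minimal R R_PID T.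
  apply: contrapT => noT.
  have A0 : A = (A 0 0)%:M.
    apply: orthogonal_values0_scalar => u v uv0; apply/eqP/negP => uAv.
    have [|c Tc _] := value_entry A u v (mx_similar_refl A) uv0; first exact/negP.
    by apply: noT; exists c.
  (* A scalar [A] is excluded by the zero ideal. *)
  have [|i j|m] := @reduce_mx_scalar _ 0 _ A (A 0 0); last exact: A_nonscalar.
    by rewrite unitr0.
  by rewrite -A0 subrr; apply: divides0.
exists B => //; rewrite Bb; apply/negPn/negP => b_nonunit.
have [p [pb p_nonunit p_prime]] := PID_prime_divisor R_PID b0 b_nonunit.
have [|i j|m] := @reduce_mx_scalar _ p _ A (B 0 0) => //; last exact: A_nonscalar.
apply: (divides_similar_scalar AB); apply: (minimal_entry_scalar R_PID) => //.
  (* Any nonzero value is a multiple of some [c] in [T], so minimality in [T] passes to all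
     values. *)
  rewrite Bb; split=> // u v uv0 uBv db; have [c Tc dc] := value_entry _ _ _ AB uv0 uBv.
  apply: (divides_trans _ dc); apply: b_min => //; exact: divides_trans dc db.
by rewrite Bb.
Qed.

Theorem theorem3p3 (R : idomainType) (R_PID : is_PID R) (n : nat)
    (n_ge3 : (3 <= n)%N) (A : 'M[R]_n)
    (A_nonscalar : forall m : idealr R, ~ is_scalar_mx (reduce_mx m A))
    (gamma : 'I_n -> R) (sum_gamma : \sum_(i < n) gamma i = \tr A) :
  exists2 B : 'M[R]_n, mx_similar A B & forall i : 'I_n, B i i = gamma i.
Proof.
case: n => [|[|[|n]]] // in n_ge3 A A_nonscalar gamma sum_gamma *.
have [B AB UB] := similar_unit_entry R_PID A_nonscalar.
have [|C BC Cgamma] := @unit_entry_similar_diag _ _ B gamma UB.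
  by rewrite -(mx_similar_trace AB).
by exists C => //; apply: mx_similar_trans BC.
Qed.
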